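(* Let $A$ be a commutative noetherian ring with $\dim A=d$ and let $n\ge 2$ be an integer. Then the map $\zeta:\mathcal{LO}(A,n)\to\pi_0(Q_{2n})(A)$ induces a bijective map $$\overline{\zeta}:\pi_0(\mathcal{LO}(A,n))\longrightarrow\pi_0(Q_{2n})(A),$$ and the inverse map is induced by $\eta:Q_{2n}(A)\to\mathcal{LO}(A,n)$.
   Context: $\mathcal{LO}(A,n)$ is the set of pairs $(I,\omega)$ with $I$ an ideal of $A$ and $\omega:A^n\twoheadrightarrow I/I^2$ a surjective $A$-homomorphism. Substituting $T=0,1$ gives two maps $\mathcal{LO}(A[T],n)\to\mathcal{LO}(A,n)$ (an ideal is sent to its image in $A$ and $\omega$ to the induced surjection), and $\pi_0(\mathcal{LO}(A,n))$ is the quotient of $\mathcal{LO}(A,n)$ by the equivalence relation generated by identifying the $T=0$ and $T=1$ specializations of each element of $\mathcal{LO}(A[T],n)$. $Q_{2n}(A)=\{(s;f_1,\ldots,f_n;g_1,\ldots,g_n)\in A^{2n+1}:\sum_{i=1}^n f_ig_i+s(s-1)=0\}$, and $\pi_0(Q_{2n})(A)$ is the quotient of $Q_{2n}(A)$ by the equivalence relation generated by $H(0)\sim H(1)$ for $H(T)\in Q_{2n}(A[T])$. For $\mathbf v=(s;f_1,\ldots,f_n;g_1,\ldots,g_n)\in Q_{2n}(A)$, $\eta(\mathbf v)=(\mathbb I(\mathbf v),\omega_{\mathbf v})$, where $\mathbb I(\mathbf v)=(f_1,\ldots,f_n,s)A$ and $\omega_{\mathbf v}:A^n\twoheadrightarrow\mathbb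 I(\mathbf v)/\mathbb I(\mathbf v)^2$ sends the standard basis vector $e_i$ to $f_i+\mathbb I(\mathbf v)^2$. The map $\zeta:\mathcal{LO}(A,n)\to\pi_0(Q_{2n})(A)$: given $(I,\omega)$, choose $f_i\in I$ with $\omega(e_i)=f_i+I^2$; there are $s\in I$ and $g_i\in A$ with $I=(f_1,\dots,f_n,s)$ and $\sum f_ig_i+s(s-1)=0$, and $\zeta(I,\omega)$ is the class of $(s;f_1,\ldots,f_n;g_1,\ldots,g_n)$, which is known to be independent of all choices. *)

(* Defs.v *)
Set Warnings "-notation-overridden,-ambiguous-paths,-redundant-canonical-projection,-projection-no-head-constant".
From HB Require Import structures.
From mathcomp Require Import all_boot all_order all_algebra.
From mathcomp Require Import generic_quotient ring_quotient ring.
From mathcomp Require Import boolp classical_sets.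
From Stdlib Require Import Relation_Operators.

Set Implicit Arguments.
Unset Strict Implicit.
Unset Printing Implicit Defensive.

Import GRing.Theory.
Local Open Scope ring_scope.
Local Open Scope classical_set_scope.
Local Open Scope quotient_scope.

(* MathComp's [idealr] only covers proper decidable ideals; the unit ideal is
   allowed here. *)
Record ideal (A : comNzRingType) := Ideal {
  ideal_set :> set A;
  ideal0 : ideal_set 0;
  idealD : forall x y, ideal_set x -> ideal_set y -> ideal_set (x + y);
  idealM : forall a x, ideal_set x -> ideal_set (a * x) }.

Lemma ideal_eqP (A : comNzRingType) (I J : ideal A) :
  I = J <-> (ideal_set I = ideal_set J).
Proof.
split=> [->//|]; case: I J => [I ? ? ?] [J ? ? ?] /= IJ.
by subst J; congr Ideal; exact: Prop_irrelevance.
Qed.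

Lemma ideal_sum (A : comNzRingType) (I : ideal A) (T : Type) (r : seq T)
    (P : pred T) (F : T -> A) :
  (forall i, P i -> ideal_set I (F i)) -> ideal_set I (\sum_(i <- r | P i) F i).
Proof. by move=> IF; elim/big_ind: _ => //; [exact: ideal0|exact: idealD]. Qed.

Section IdealGen.
Variable A : comNzRingType.

Definition ideal_gen_set (S : set A) : set A :=
  [set x | exists m (a y : 'I_m -> A),
    (forall i, S (y i)) /\ x = \sum_(i < m) a i * y i].

Lemma ideal_gen_min_set (S : set A) (I : ideal A) :
  S `<=` I -> ideal_gen_set S `<=` I.
Proof.
move=> SI x [m [a [y [Sy ->]]]]; apply: ideal_sum => i _.
by apply: idealM; exact: SI.
Qed.

Fact ideal_gen0 S : ideal_gen_set S 0.
Proof.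
exists 0%N, (fun=> 0), (fun=> 0); rewrite big_ord0; split=> //.
by case.
Qed.

Fact ideal_genD S x y :
  ideal_gen_set S x -> ideal_gen_set S y -> ideal_gen_set S (x + y).
Proof.
move=> [m [a [u [Su ->]]]] [p [b [v [Sv ->]]]].
pose w T (g : 'I_m -> T) (h : 'I_p -> T) (i : 'I_(m + p)) :=
  match fintype.split i with inl j => g j | inr j => h j end.
exists (m + p)%N, (w _ a b), (w _ u v); split.
  by move=> i; rewrite /w; case: (fintype.split i).
rewrite big_split_ord /=; congr (_ + _); apply: eq_bigr => i _; rewrite /w.
  by rewrite (unsplitK (inl i)).
by rewrite (unsplitK (inr i)).
Qed.

Fact ideal_genM S a x : ideal_gen_set S x -> ideal_gen_set S (a * x).
Proof.
move=> [m [b [u [Su ->]]]]; exists m, (fun i => a * b i), u; split=> //.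
by rewrite big_distrr; apply: eq_bigr => i _; rewrite /= mulrA.
Qed.

Definition ideal_gen (S : set A) : ideal A :=
  Ideal (ideal_gen0 S) (@ideal_genD S) (@ideal_genM S).

Lemma ideal_gen_min (S : set A) (I : ideal A) : S `<=` I -> ideal_gen S `<=` I.
Proof. exact: ideal_gen_min_set. Qed.

Lemma sub_ideal_gen (S : set A) : S `<=` ideal_gen S.
Proof.
move=> x Sx; exists 1%N, (fun=> 1), (fun=> x); split=> //.
by rewrite big_ord1 mul1r.
Qed.

Definition ideal_mul (I J : ideal A) : ideal A :=
  ideal_gen [set x * y | x in I & y in J].

Definition ideal_sq (I : ideal A) : ideal A := ideal_mul I I.

End IdealGen.

Definition noetherian (A : comNzRingType) : Prop :=
  forall I : ideal A, exists s : seq A, I = ideal_gen [set` s].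

Definition prime_ideal (A : comNzRingType) (P : set A) : Prop :=
  idealr_closed (fun x => x \in P) /\ prime_idealr_closed (fun x => x \in P).

Definition prime_chain (A : comNzRingType) (m : nat) (P : 'I_m.+1 -> set A) :=
  (forall i, prime_ideal (P i)) /\
  (forall i j : 'I_m.+1, (i < j)%N -> P i `<` P j).

Definition krull_dim (A : comNzRingType) (d : nat) : Prop :=
  (exists P : 'I_d.+1 -> set A, prime_chain P) /\
  (forall m (P : 'I_m.+1 -> set A), prime_chain P -> (m <= d)%N).

Section Cotangent.
Variables (A : comNzRingType) (I : ideal A).

(* I as an A-module *)
Record ideal_mod := IdealMod {
  ideal_val : A^o;
  ideal_valP : ideal_val \in ideal_set I }.

HB.instance Definition _ := [isSub for ideal_val].
HB.instance Definition _ := [Choice of ideal_mod by <:].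

Fact ideal_submod_closed :
  subsemimod_closed (fun x : A^o => x \in ideal_set I).
Proof.
split=> [|a x]; last by rewrite !in_setE; exact: idealM.
split=> [|x y]; rewrite !in_setE; [exact: ideal0|exact: idealD].
Qed.

HB.instance Definition _ := GRing.SubChoice_isSubLmodule.Build A A^o
  (fun x => x \in ideal_set I) ideal_mod ideal_submod_closed.

Lemma ideal_valZ (a : A) (u : ideal_mod) :
  ideal_val (a *: u) = a * (ideal_val u : A).
Proof. by rewrite -[LHS]/(val (a *: u)) linearZ. Qed.

Definition ideal_sq_sub : {pred ideal_mod} :=
  fun x => val x \in ideal_set (ideal_sq I).

Fact ideal_sq_sub_closed : subsemimod_closed ideal_sq_sub.
Proof.
have E x : (x \in ideal_sq_sub) = (val x \in ideal_set (ideal_sq I)) by [].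
split=> [|a x]; last by rewrite !E !in_setE linearZ; exact: idealM.
split=> [|x y]; rewrite !E !in_setE ?raddf0 ?raddfD.
  exact: ideal0.
exact: idealD.
Qed.

HB.instance Definition _ :=
  GRing.isSubmodClosed.Build A ideal_mod ideal_sq_sub ideal_sq_sub_closed.

Definition cotangent := Quotient.quot (ideal_sq_sub : zmodClosed ideal_mod).

HB.instance Definition _ := ZmodQuotient.on cotangent.

Definition cotangent_scale (a : A) : cotangent -> cotangent :=
  lift_op1 cotangent (fun x : ideal_mod => a *: x).

Lemma cotangent_eqP (x y : ideal_mod) :
  \pi_cotangent x = \pi_cotangent y <-> ideal_set (ideal_sq I) (val x - val y).
Proof.
have E : (\pi_cotangent x == \pi_cotangent y) = (x - y \in ideal_sq_sub).
  by rewrite -Quotient.idealrBE.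
split=> [/eqP|xy]; last apply/eqP; rewrite E.
  by move/set_mem; rewrite raddfB.
by apply/mem_set; rewrite raddfB.
Qed.

Lemma cotangent_scale_pi a x :
  cotangent_scale a (\pi_cotangent x) = \pi_cotangent (a *: x).
Proof.
rewrite /cotangent_scale; unlock.
apply/cotangent_eqP; rewrite [val _]ideal_valZ [val (a *: x)]ideal_valZ -mulrBr.
by apply: idealM; apply/cotangent_eqP; rewrite reprK.
Qed.

Fact cotangent_scaleA a b v :
  cotangent_scale a (cotangent_scale b v) = cotangent_scale (a * b) v.
Proof. by rewrite -[v]reprK !cotangent_scale_pi scalerA. Qed.

Fact cotangent_scale1 : left_id 1 cotangent_scale.
Proof. by move=> v; rewrite -[v]reprK cotangent_scale_pi scale1r. Qed.

Fact cotangent_scaleDr : right_distributive cotangent_scale +%R.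
Proof.
move=> a u v; rewrite -[u]reprK -[v]reprK -raddfD !cotangent_scale_pi.
by rewrite scalerDr raddfD.
Qed.

Fact cotangent_scaleDl v : {morph cotangent_scale^~ v : a b / a + b}.
Proof.
by move=> a b; rewrite -[v]reprK !cotangent_scale_pi scalerDl raddfD.
Qed.

HB.instance Definition _ := GRing.Zmodule_isLmodule.Build A cotangent
  cotangent_scaleA cotangent_scale1 cotangent_scaleDr cotangent_scaleDl.

(* the element f + I^2 of I/I^2, for f in I *)
Definition cotangent_class (f : A) (fI : f \in ideal_set I) : cotangent :=
  \pi_cotangent (IdealMod fI).

End Cotangent.

Lemma cotangentP (A : comNzRingType) (I : ideal A) (x : cotangent I) :
  exists f (fI : f \in ideal_set I), x = cotangent_class fI.
Proof.
exists (ideal_val (repr x)), (ideal_valP (repr x)); rewrite -{1}[x]reprK.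
by apply/cotangent_eqP; rewrite subrr; exact: ideal0.
Qed.

Lemma cotangent_class_eq (A : comNzRingType) (I : ideal A) (f g : A)
    (fI : f \in ideal_set I) (gI : g \in ideal_set I) :
  cotangent_class fI = cotangent_class gI <-> ideal_set (ideal_sq I) (f - g).
Proof. exact: cotangent_eqP. Qed.

Lemma cotangent_classD (A : comNzRingType) (I : ideal A) (f g : A)
    (fI : f \in ideal_set I) (gI : g \in ideal_set I)
    (fgI : f + g \in ideal_set I) :
  cotangent_class fgI = cotangent_class fI + cotangent_class gI.
Proof.
rewrite /cotangent_class -raddfD; congr (\pi_(cotangent I) _).
by apply: val_inj; rewrite raddfD.
Qed.

Lemma cotangent_classZ (A : comNzRingType) (I : ideal A) (a f : A)
    (fI : f \in ideal_set I) (afI : a * f \in ideal_set I) :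
  cotangent_class afI = a *: cotangent_class fI.
Proof.
rewrite /cotangent_class [RHS]cotangent_scale_pi; congr (\pi_(cotangent I) _).
by apply: val_inj; rewrite linearZ.
Qed.

(* X modulo the equivalence relation generated by r *)
Section Pi0.
Variables (X : choiceType) (r : X -> X -> Prop).

Definition gen_equiv : rel X := fun x y => `[< clos_refl_sym_trans X r x y >].

Fact gen_equiv_is_equiv : equiv_class_of gen_equiv.
Proof.
split=> [x|x y|y x z]; first by apply/asboolP; exact: rst_refl.
- by apply/asboolP/asboolP => ?; exact: rst_sym.
- by move=> /asboolP xy /asboolP yz; apply/asboolP; exact: rst_trans xy yz.
Qed.

Canonical gen_equiv_equiv := EquivRelPack gen_equiv_is_equiv.
Canonical gen_equiv_encModRel := defaultEncModRel gen_equiv.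

Definition pi0 := {eq_quot gen_equiv}.

HB.instance Definition _ : EqQuotient X gen_equiv pi0 := EqQuotient.on pi0.
HB.instance Definition _ := Choice.on pi0.

Definition pi0_class (x : X) : pi0 := \pi_pi0 x.

Lemma pi0_classP (x y : X) :
  pi0_class x = pi0_class y <-> clos_refl_sym_trans X r x y.
Proof.
have E : (pi0_class x == pi0_class y) = gen_equiv x y by exact: pi_eq_quot.
split=> [/eqP|xy]; first by rewrite E => /asboolP.
by apply/eqP; rewrite E; apply/asboolP.
Qed.

Lemma pi0_class_surj (c : pi0) : exists x, c = pi0_class x.
Proof. by exists (repr c); rewrite /pi0_class reprK. Qed.

End Pi0.

(* 'rV[A]_n is the free module A^n, with standard basis delta_mx 0 i *)
Record LO (A : comNzRingType) (n : nat) := MkLO {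
  LO_ideal : ideal A;
  LO_map : {linear 'rV[A]_n -> cotangent LO_ideal};
  LO_surj : forall y, exists x, LO_map x = y }.

HB.instance Definition _ A n := gen_eqMixin (LO A n).
HB.instance Definition _ A n := gen_choiceMixin (LO A n).

Section Specialization.
Variables (A : comNzRingType) (t : A).

Section Ideal.
Variable J : ideal {poly A}.

Definition ideal_spec_set : set A := [set p.[t] | p in ideal_set J].

Fact ideal_spec0 : ideal_spec_set 0.
Proof. by exists 0; [exact: ideal0|rewrite horner0]. Qed.

Fact ideal_specD x y :
  ideal_spec_set x -> ideal_spec_set y -> ideal_spec_set (x + y).
Proof.
move=> [p Jp <-] [q Jq <-]; exists (p + q); last by rewrite hornerD.
exact: idealD.
Qed.

Fact ideal_specM a x : ideal_spec_set x -> ideal_spec_set (a * x).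
Proof.
move=> [p Jp <-]; exists (a%:P * p); last by rewrite hornerM hornerC.
exact: idealM.
Qed.

(* the image of J under T |-> t *)
Definition ideal_spec : ideal A := Ideal ideal_spec0 ideal_specD ideal_specM.

Fact ideal_spec_mem (p : {poly A}) :
  p \in ideal_set J -> p.[t] \in ideal_set ideal_spec.
Proof. by move/set_mem=> Jp; apply/mem_set; exists p. Qed.

Lemma ideal_spec_sq p :
  ideal_set (ideal_sq J) p -> ideal_set (ideal_sq ideal_spec) p.[t].
Proof.
move=> [m [a [y [Jy ->]]]]; rewrite horner_sum; apply: ideal_sum => i _.
rewrite hornerM; apply: idealM; case: (Jy i) => u Ju [v Jv <-].
rewrite hornerM; apply: sub_ideal_gen; exists u.[t]; first by exists u.
by exists v.[t] => //; exists v.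
Qed.

(* J/J^2 -> J(t)/J(t)^2, induced by T |-> t *)
Definition cotangent_spec (x : cotangent J) : cotangent ideal_spec :=
  cotangent_class (ideal_spec_mem (ideal_valP (repr x))).

Lemma cotangent_spec_class (p : {poly A}) (Jp : p \in ideal_set J) :
  cotangent_spec (cotangent_class Jp) = cotangent_class (ideal_spec_mem Jp).
Proof.
apply/cotangent_class_eq; rewrite -hornerN -hornerD; apply: ideal_spec_sq.
apply/(cotangent_class_eq (ideal_valP _) Jp); rewrite -[RHS]reprK.
by apply/cotangent_eqP; rewrite subrr; exact: ideal0.
Qed.

Lemma cotangent_specD x y :
  cotangent_spec (x + y) = cotangent_spec x + cotangent_spec y.
Proof.
have [f [fJ ->]] := cotangentP x; have [g [gJ ->]] := cotangentP y.
have fgJ : f + g \in ideal_set J.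
  by apply/mem_set; apply: idealD; apply/set_mem.
rewrite -(cotangent_classD fJ gJ fgJ) !cotangent_spec_class.
have H : f.[t] + g.[t] \in ideal_set ideal_spec.
  by rewrite -hornerD; exact: ideal_spec_mem.
rewrite -(cotangent_classD _ _ H); apply/cotangent_class_eq; rewrite hornerD subrr; exact: ideal0.
Qed.

Lemma cotangent_specZ p x :
  cotangent_spec (p *: x) = p.[t] *: cotangent_spec x.
Proof.
have [f [fJ ->]] := cotangentP x.
have pfJ : p * f \in ideal_set J.
  by apply/mem_set; apply: idealM; apply/set_mem.
rewrite -(cotangent_classZ fJ pfJ) !cotangent_spec_class.
have H : p.[t] * f.[t] \in ideal_set ideal_spec.
  by rewrite -hornerM; exact: ideal_spec_mem.
rewrite -(cotangent_classZ _ H); apply/cotangent_class_eq; rewrite hornerM subrr; exact: ideal0.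
Qed.

Lemma cotangent_spec_sum (T : Type) (r : seq T) (F : T -> cotangent J) :
  cotangent_spec (\sum_(i <- r) F i) = \sum_(i <- r) cotangent_spec (F i).
Proof.
elim: r => [|i r IH]; last by rewrite !big_cons cotangent_specD IH.
rewrite !big_nil; have /eqP := cotangent_specD 0 0.
by rewrite addr0 -[X in X == _]addr0 => /eqP /addrI <-.
Qed.

End Ideal.

Section Map.
Variables (n : nat) (H : LO {poly A} n).

(* v : A^n is lifted to constants in A[T]^n; LO_spec_funE shows that the choice
   of the lift does not matter. *)
Definition LO_spec_fun (v : 'rV[A]_n) : cotangent (ideal_spec (LO_ideal H)) :=
  cotangent_spec (LO_map H (map_mx polyC v)).

Fact LO_spec_fun_linear : linear LO_spec_fun.
Proof.
move=> a u v; rewrite /LO_spec_fun map_mxD map_mxZ linearP cotangent_specD.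
by rewrite cotangent_specZ hornerC.
Qed.

HB.instance Definition _ := GRing.isLinear.Build A 'rV[A]_n
  (cotangent (ideal_spec (LO_ideal H))) *:%R LO_spec_fun LO_spec_fun_linear.

Lemma LO_spec_funE (V : 'rV[{poly A}]_n) :
  LO_spec_fun (\row_i (V 0 i).[t]) = cotangent_spec (LO_map H V).
Proof.
rewrite /LO_spec_fun [in RHS](row_sum_delta V).
rewrite [in LHS](row_sum_delta (map_mx _ _)).
rewrite !linear_sum !cotangent_spec_sum; apply: eq_bigr => i _.
by rewrite !linearZ !cotangent_specZ !mxE hornerC.
Qed.

Fact LO_spec_surj y : exists x, LO_spec_fun x = y.
Proof.
have [f [fJ ->]] := cotangentP y; have [p Jp pf] := set_mem fJ.
have [V VE] := LO_surj (cotangent_class (mem_set Jp)).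
exists (\row_i (V 0 i).[t]); rewrite LO_spec_funE VE cotangent_spec_class.
by apply/cotangent_class_eq; rewrite pf subrr; exact: ideal0.
Qed.

Definition LO_spec : LO A n :=
  @MkLO A n (ideal_spec (LO_ideal H)) LO_spec_fun LO_spec_surj.

End Map.
End Specialization.

Definition LO_homotopy (A : comNzRingType) (n : nat) (x y : LO A n) : Prop :=
  exists H : LO {poly A} n, x = LO_spec 0 H /\ y = LO_spec 1 H.

Definition pi0_LO (A : comNzRingType) (n : nat) := pi0 (@LO_homotopy A n).

Record Q2n (A : comNzRingType) (n : nat) := MkQ2n {
  Q_s : A;
  Q_f : 'rV[A]_n;
  Q_g : 'rV[A]_n;
  Q_eq : \sum_(i < n) Q_f 0 i * Q_g 0 i + Q_s * (Q_s - 1) = 0 }.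

HB.instance Definition _ A n := gen_eqMixin (Q2n A n).
HB.instance Definition _ A n := gen_choiceMixin (Q2n A n).

Fact Q_spec_eq (A : comNzRingType) (t : A) n (H : Q2n {poly A} n) :
  \sum_(i < n) (map_mx (horner_eval t) (Q_f H)) 0 i
               * (map_mx (horner_eval t) (Q_g H)) 0 i
    + (Q_s H).[t] * ((Q_s H).[t] - 1) = 0.
Proof.
have := congr1 (horner_eval t) (Q_eq H); rewrite rmorph0; apply: etrans.
rewrite rmorphD rmorphM rmorphB rmorph1 rmorph_sum; congr (_ + _).
by apply: eq_bigr => i _; rewrite rmorphM !mxE.
Qed.

Definition Q_spec (A : comNzRingType) (t : A) n (H : Q2n {poly A} n) :
  Q2n A n := MkQ2n (Q_spec_eq t H).

Definition Q_homotopy (A : comNzRingType) (n : nat) (x y : Q2n A n) : Prop :=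
  exists H : Q2n {poly A} n, x = Q_spec 0 H /\ y = Q_spec 1 H.

Definition pi0_Q (A : comNzRingType) (n : nat) := pi0 (@Q_homotopy A n).

Section Eta.
Variables (A : comNzRingType) (n : nat) (v : Q2n A n).

Definition Q_ideal : ideal A :=
  ideal_gen ([set Q_f v 0 i | i in [set: 'I_n]] `|` [set Q_s v]).

Fact Q_f_mem i : Q_f v 0 i \in ideal_set Q_ideal.
Proof. by apply/mem_set; apply: sub_ideal_gen; left; exists i. Qed.

Fact Q_s_mem : Q_s v \in ideal_set Q_ideal.
Proof. by apply/mem_set; apply: sub_ideal_gen; right. Qed.

Definition eta_fun (x : 'rV[A]_n) : cotangent Q_ideal :=
  \sum_(i < n) x 0 i *: cotangent_class (Q_f_mem i).

Fact eta_fun_linear : linear eta_fun.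
Proof.
move=> a x y; rewrite /eta_fun scaler_sumr -big_split /=.
by apply: eq_bigr => i _; rewrite !mxE scalerDl scalerA.
Qed.

HB.instance Definition _ := GRing.isLinear.Build A 'rV[A]_n
  (cotangent Q_ideal) *:%R eta_fun eta_fun_linear.

Lemma eta_fun_delta i :
  eta_fun (delta_mx 0 i) = cotangent_class (Q_f_mem i).
Proof.
rewrite /eta_fun (bigD1 i) //= big1 => [|j ji].
  by rewrite !mxE !eqxx scale1r addr0.
by rewrite !mxE (negPf ji) andbF scale0r.
Qed.

Lemma eta_fun_class (x : 'rV[A]_n)
    (xI : \sum_(i < n) x 0 i * Q_f v 0 i \in ideal_set Q_ideal) :
  eta_fun x = cotangent_class xI.
Proof.
pose F i : ideal_mod Q_ideal := x 0 i *: IdealMod (Q_f_mem i).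
transitivity (\pi_(cotangent Q_ideal) (\sum_(i < n) F i)).
  rewrite raddf_sum; apply: eq_bigr => i _; exact: cotangent_scale_pi.
congr (\pi_(cotangent Q_ideal) _); apply: val_inj; rewrite raddf_sum.
by apply: eq_bigr => i _; exact: ideal_valZ.
Qed.

Lemma Q_idealP (y : A) :
  ideal_set Q_ideal y <->
  exists a (b : 'rV[A]_n), y = a * Q_s v + \sum_(i < n) b 0 i * Q_f v 0 i.
Proof.
split=> [|[a [b ->]]]; last first.
  apply: idealD; first by apply: idealM; exact: set_mem Q_s_mem.
  by apply: ideal_sum => i _; apply: idealM; exact: set_mem (Q_f_mem i).
pose S : set A :=
  [set y | exists a (b : 'rV[A]_n),
    y = a * Q_s v + \sum_(i < n) b 0 i * Q_f v 0 i].
have S0 : S 0.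
  exists 0, 0; rewrite mul0r add0r big1 // => i _; by rewrite mxE mul0r.
have SD x z : S x -> S z -> S (x + z).
  move=> [a [b ->]] [c [d ->]]; exists (a + c), (b + d).
  rewrite mulrDl addrACA -big_split; congr (_ + _).
  by apply: eq_bigr => i _; rewrite mxE mulrDl.
have SM c x : S x -> S (c * x).
  move=> [a [b ->]]; exists (c * a), (c *: b).
  rewrite mulrDr mulrA big_distrr; congr (_ + _).
  by apply: eq_bigr => i _; rewrite mxE /= mulrA.
apply: (@ideal_gen_min A _ (Ideal S0 SD SM)) => _ [[i _ <-]|->].
  exists 0, (delta_mx 0 i); rewrite mul0r add0r (bigD1 i) //= big1 => [|j ji].
    by rewrite !mxE !eqxx mul1r addr0.
  by rewrite !mxE (negPf ji) andbF mul0r.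
exists 1, 0; rewrite mul1r big1 ?addr0 // => i _; by rewrite mxE mul0r.
Qed.

Lemma Q_eq_s : Q_s v = Q_s v * Q_s v + \sum_(i < n) Q_g v 0 i * Q_f v 0 i.
Proof.
under eq_bigr do rewrite mulrC.
have /eqP := Q_eq v; rewrite mulrBr mulr1 addrA subr_eq0 addrC => /eqP.
by move=> ->.
Qed.

Fact eta_surj y : exists x, eta_fun x = y.
Proof.
have [f [fI ->]] := cotangentP y.
have [a [b fE]] := (Q_idealP f).1 (set_mem fI).
pose x := b + a *: Q_g v.
have xI : \sum_(i < n) x 0 i * Q_f v 0 i \in ideal_set Q_ideal.
  apply/mem_set; apply: ideal_sum => i _; apply: idealM.
  exact: set_mem (Q_f_mem i).
exists x; rewrite (eta_fun_class xI); apply/cotangent_class_eq.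
have -> : \sum_(i < n) x 0 i * Q_f v 0 i - f = (- a) * (Q_s v * Q_s v).
  rewrite fE {1}Q_eq_s mulrDr; under eq_bigr do rewrite !mxE mulrDl -mulrA.
  rewrite big_split -big_distrr /= mulNr.
  set X := \sum_(i < n) _; set Y := a * \sum_(i < n) _; set Z := a * _.
  by rewrite -(addrA Z) (addrC Y X) opprD addrCA subrr addr0.
apply: idealM; apply: sub_ideal_gen; have s := set_mem Q_s_mem.
by exists (Q_s v) => //; exists (Q_s v).
Qed.

Definition eta : LO A n := @MkLO A n Q_ideal eta_fun eta_surj.

End Eta.

Definition zeta_lift (A : comNzRingType) (n : nat) (x : LO A n) (v : Q2n A n) :=
  [/\ forall i : 'I_n, exists fI : Q_f v 0 i \in ideal_set (LO_ideal x),
        LO_map x (delta_mx 0 i) = cotangent_class fI,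
      Q_s v \in ideal_set (LO_ideal x) &
      LO_ideal x = Q_ideal v].

Section ZetaLift.
Variables (A : comNzRingType) (n : nat) (x : LO A n).

(* Nakayama's lemma for I = J + I^2, I finitely generated *)
Lemma ideal_sq_nakayama (I J : ideal A) (ys : seq A) :
  (forall a, ideal_set I a ->
     exists2 b, ideal_set J b & ideal_set (ideal_sq I) (a - b)) ->
  (forall y, y \in ys -> ideal_set I y) ->
  (exists2 s, ideal_set I s & forall a, ideal_set I a ->
     exists2 b, ideal_set J b & ideal_set (ideal_gen [set` ys]) ((1 - s) * a - b)) ->
  exists2 s, ideal_set I s &
    forall a, ideal_set I a -> ideal_set J ((1 - s) * a).
Proof.
have ideal_cons y zs a : ideal_set (ideal_gen [set` y :: zs]) a ->
    exists c, ideal_set (ideal_gen [set` zs]) (a - c * y).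
  move=> [m [b [u [Su ->]]]]; elim: m b u Su => [|m IH] b u Su.
    by exists 0; rewrite big_ord0 mul0r subrr; exact: ideal0.
  have [|c Hc] := IH (b \o lift ord0) (u \o lift ord0).
    by move=> i; exact: Su.
  have := Su ord0; rewrite {1}/mkset in_cons big_ord_recl => /orP[/eqP ->|uz].
    exists (b ord0 + c); rewrite mulrDl opprD addrACA subrr add0r; exact: Hc.
  exists c; rewrite -addrA; apply: idealD; last exact: Hc.
  by apply: idealM; exact: sub_ideal_gen.
move=> IJ; elim: ys => [|y ys IH] ysI [s Is sP].
  exists s => // a Ia; have [b Jb [m [c [u [Su E]]]]] := sP a Ia.
  suff -> : (1 - s) * a = b by [].
  apply/eqP; rewrite -subr_eq0 E big1 // => i _.
  by have := Su i; rewrite /= in_nil.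
have Iy : ideal_set I y by apply: ysI; rewrite mem_head.
apply: IH => [z zys|]; first by apply: ysI; rewrite in_cons zys orbT.
(* (1 - s) y = a y modulo J + (ys), with a in I *)
have [a Ia [b Jb aP]] : exists2 a, ideal_set I a & exists2 b, ideal_set J b &
    ideal_set (ideal_gen [set` ys]) ((1 - s) * y - a * y - b).
  have [p Jp [m [c [u [Su E]]]]] := IJ y Iy.
  have {Su} : forall i : 'I_m, exists e, ideal_set I e /\ exists2 q,
      ideal_set J q & ideal_set (ideal_gen [set` ys])
        ((1 - s) * u i - e * y - q).
    move=> i; case: (Su i) => v Iv [w Iw <-].
    have [q Jq /ideal_cons [e eP]] := sP w Iw.
    exists (v * e); split; first by rewrite mulrC; exact: idealM.
    exists (v * q); first exact: idealM.
    have -> : (1 - s) * (v * w) - v * e * y - v * q =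
        v * ((1 - s) * w - q - e * y).
      by ring.
    exact: idealM.
  move=> /choice [e eP].
  exists (\sum_(i < m) c i * e i).
    by apply: ideal_sum => i _; apply: idealM; case: (eP i).
  have {}eP i : exists q, ideal_set J q /\ ideal_set (ideal_gen [set` ys])
      ((1 - s) * u i - e i * y - q).
    by case: (eP i) => _ [q]; exists q.
  have [q qP] := choice eP.
  exists ((1 - s) * p + \sum_(i < m) c i * q i).
    apply: idealD; first exact: idealM.
    by apply: ideal_sum => i _; apply: idealM; case: (qP i).
  have -> : (1 - s) * y - (\sum_(i < m) c i * e i) * y -
      ((1 - s) * p + \sum_(i < m) c i * q i) =
      \sum_(i < m) c i * ((1 - s) * u i - e i * y - q i).
    rewrite [in RHS](eq_bigr (fun i => (1 - s) * (c i * u i) -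
      (c i * e i) * y - c i * q i)) => [|i _]; last by ring.
    rewrite !sumrB -big_distrr -big_distrl /= -E; by ring.
  by apply: ideal_sum => i _; apply: idealM; case: (qP i).
exists (s + (1 - s) * (s + a)) => [|w Iw].
  by apply: idealD => //; apply: idealM; exact: idealD.
have [q Jq /ideal_cons [c cP]] := sP w Iw.
exists ((1 - s - a) * q + c * b); first by apply: idealD; exact: idealM.
have -> : (1 - (s + (1 - s) * (s + a))) * w - ((1 - s - a) * q + c * b) =
    (1 - s - a) * ((1 - s) * w - q - c * y) + c * ((1 - s) * y - a * y - b).
  by ring.
by apply: idealD; exact: idealM.
Qed.

Lemma zeta_lift_exists : noetherian A -> exists v, zeta_lift x v.
Proof.
move=> hA; set I := LO_ideal x.
have /choice [f fP] : forall i : 'I_n, exists a : A,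
    exists aI : a \in ideal_set I, LO_map x (delta_mx 0 i) = cotangent_class aI.
  by move=> i; exact: cotangentP.
pose J : ideal A := ideal_gen [set f i | i in [set: 'I_n]].
have JI a : ideal_set J a -> ideal_set I a.
  by apply: ideal_gen_min => _ [i _ <-]; case: (fP i) => aI _; exact: set_mem aI.
have JP a : ideal_set J a -> exists b : 'I_n -> A, a = \sum_(i < n) f i * b i.
  pose S : set A := [set a | exists b : 'I_n -> A, a = \sum_(i < n) f i * b i].
  have S0 : S 0 by exists (fun=> 0); rewrite big1 // => i _; rewrite mulr0.
  have SD u v : S u -> S v -> S (u + v).
    move=> [b ->] [c ->]; exists (fun i => b i + c i); rewrite -big_split.
    by apply: eq_bigr => i _; rewrite /= mulrDr.
  have SM c u : S u -> S (c * u).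
    move=> [b ->]; exists (fun i => c * b i); rewrite big_distrr.
    by apply: eq_bigr => i _; rewrite /= mulrCA.
  apply: (@ideal_gen_min A _ (Ideal S0 SD SM)) => _ [i _ <-].
  exists (fun j => (j == i)%:R); rewrite (bigD1 i) //= eqxx mulr1 big1 ?addr0 //.
  by move=> j /negPf ->; rewrite mulr0.
have JfI i : ideal_set J (f i) by apply: sub_ideal_gen; exists i.
have IJ a : ideal_set I a ->
    exists2 b, ideal_set J b & ideal_set (ideal_sq I) (a - b).
  move=> Ia; have [w wE] := LO_surj (cotangent_class (mem_set Ia)).
  pose b := \sum_(i < n) w 0 i * f i.
  have Jb : ideal_set J b by apply: ideal_sum => i _; exact: idealM.
  exists b => //; apply/(cotangent_class_eq (mem_set Ia) (mem_set (JI _ Jb))).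
  rewrite -wE [in LHS](row_sum_delta w) linear_sum /=.
  pose F i : ideal_mod I := w 0 i *: IdealMod (mem_set (JI _ (JfI i))).
  transitivity (\pi_(cotangent I) (\sum_(i < n) F i)).
    rewrite raddf_sum; apply: eq_bigr => i _; have [fI E] := fP i.
    rewrite linearZ [LHS]/= E; apply: etrans (cotangent_scale_pi _ _).
    by congr (_ *: _); apply/cotangent_class_eq; rewrite subrr; exact: ideal0.
  congr (\pi_(cotangent I) _); apply: val_inj; rewrite raddf_sum.
  by apply: eq_bigr => i _; exact: ideal_valZ.
have [ys ysE] := hA I.
have ysI y : y \in ys -> ideal_set I y.
  by move=> yys; rewrite ysE; exact: sub_ideal_gen.
have [s Is sP] : exists2 s, ideal_set I s &
    forall a, ideal_set I a -> ideal_set J ((1 - s) * a).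
  apply: (ideal_sq_nakayama IJ ysI); exists 0; first exact: ideal0.
  move=> a Ia; exists 0; first exact: ideal0.
  by rewrite !subr0 mul1r -ysE.
have [g gE] := JP _ (sP s Is).
have eqn : \sum_(i < n) (\row_i f i) 0 i * (\row_i g i) 0 i + s * (s - 1) = 0.
  under eq_bigr do rewrite !mxE.
  by rewrite -gE; ring.
exists (MkQ2n eqn); split.
- move=> i; have [fI E] := fP i.
  have fI' : (\row_i f i) 0 i \in ideal_set I by rewrite mxE.
  exists fI'; rewrite E; apply/cotangent_class_eq.
  by rewrite mxE subrr; exact: ideal0.
- exact: mem_set.
apply/ideal_eqP/seteqP; split=> [a Ia|]; last first.
  apply: ideal_gen_min => _ [[i _ <-]|-> //] /=; rewrite mxE; exact: JI.
have -> : a = (1 - s) * a + a * s by ring.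
apply: idealD; last by apply: idealM; apply: sub_ideal_gen; right.
apply: (@ideal_gen_min A _ _ _ _ (sP a Ia)) => _ [i _ <-].
by apply: sub_ideal_gen; left; exists i => //=; rewrite mxE.
Qed.

End ZetaLift.

(* One choice of (s; f; g) for each (I, omega). *)
Definition zeta (A : comNzRingType) (n : nat) (hA : noetherian A) (x : LO A n) :
  pi0_Q A n :=
  pi0_class (@Q_homotopy A n) (projT1 (cid (zeta_lift_exists x hA))).

(* Main.v *)
(** Since [zeta_lift x v] amounts to [eta v = x], the map [eta] is onto, also
    over the noetherian ring A[T], and it commutes with T |-> 0, 1.  Everything
    then reduces to: if [eta v = eta w], then [v] and [w] are homotopic.  So let
    [v] and [w] have the same ideal I, with f-parts f and f' congruent modulo I^2.
    The row F(T) = f + T (f' - f) generates I[T] modulo I[T]^2, so by Nakayama it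
    is the f-part of a point of Q_2n(A[T]) with ideal I[T].  Its specializations
    at 0 and 1 have ideal I and f-parts f and f', and two points with the same
    ideal and the same f-part are joined by one explicit homotopy. *)
Require Import Defs.
From mathcomp Require Import all_boot all_order all_algebra.
From mathcomp Require Import generic_quotient ring zify.
From mathcomp Require Import boolp classical_sets.
From Stdlib Require Import Relation_Operators.

Import GRing.Theory.
Local Open Scope ring_scope.
Local Open Scope classical_set_scope.

Lemma idealB (A : comNzRingType) (I : ideal A) (x y : A) :
  ideal_set I x -> ideal_set I y -> ideal_set I (x - y).
Proof. by move=> Ix Iy; rewrite -mulN1r; apply: idealD => //; apply: idealM. Qed.

(** * Hilbert's basis theorem *)

Section HilbertBasis.
Variable A : comNzRingType.
Implicit Types I K : ideal {poly A}.

(** Bounding the size, instead of fixing the degree, admits a vanishing coefficient: these are the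
    leading coefficients of the degree-[d] elements of [I], together with 0, so they form an
    ideal. *)
Definition lead_ideal_set (d : nat) (I : ideal {poly A}) : set A :=
  [set a | exists p : {poly A},
    [/\ ideal_set I p, (size p <= d.+1)%N & p`_d = a]].

Fact lead_ideal0 d I : lead_ideal_set d I 0.
Proof. by exists 0; rewrite coef0 size_poly0; split=> //; exact: ideal0. Qed.

Fact lead_idealD d I a b :
  lead_ideal_set d I a -> lead_ideal_set d I b -> lead_ideal_set d I (a + b).
Proof.
move=> [p [Ip sp <-]] [q [Iq sq <-]]; exists (p + q); rewrite coefD.
split=> //; first exact: idealD.
by rewrite (leq_trans (size_polyD _ _)) // geq_max sp.
Qed.

Fact lead_idealM d I c a :
  lead_ideal_set d I a -> lead_ideal_set d I (c * a).
Proof.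
move=> [p [Ip sp <-]]; exists (c%:P * p); rewrite coefCM.
split=> //; first exact: idealM.
by rewrite mul_polyC (leq_trans (size_scale_leq _ _)).
Qed.

Definition lead_ideal d I : ideal A :=
  Ideal (lead_ideal0 d I) (lead_idealD d I) (lead_idealM d I).

Lemma lead_ideal_leq d e I : (d <= e)%N -> lead_ideal d I `<=` lead_ideal e I.
Proof.
move=> de a [p [Ip sp <-]]; exists ('X^(e - d) * p); split.
- exact: idealM.
- apply: (leq_trans (size_polyMleq _ _)); rewrite size_polyXn; lia.
- by rewrite coefXnM ltnNge leq_subr /= subKn.
Qed.

(** Induction on size: subtracting from [p] an element of [K] with the same top coefficient leaves a
    shorter polynomial, still in [I] because [K] lies in [I]. *)
Lemma lead_ideal_sub I K : K `<=` I ->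
  (forall d, lead_ideal d I `<=` lead_ideal d K) -> I `<=` K.
Proof.
move=> KI LIK p; have [d] := ubnP (size p); elim: d p => // d IH p sp Ip.
have [p0|p0] := eqVneq (size p) 0%N.
  by move/eqP: p0; rewrite size_poly_eq0 => /eqP ->; exact: ideal0.
have [|q [Kq sq qd]] := LIK (size p).-1 p`_(size p).-1.
  by exists p; split=> //; lia.
rewrite -[p](GRing.subrK q); apply: idealD => //; apply: IH; last first.
  by apply: idealB => //; exact: (KI q).
apply: (@leq_ltn_trans (size p).-1); last by lia.
apply/leq_sizeP => j; rewrite leq_eqVlt coefB => /predU1P[<-|lt_j].
  by rewrite qd subrr.
have pj : (size p <= j)%N by lia.
have qj : (size q <= j)%N by move: (leq_trans sq lt_j).
by rewrite !nth_default // subrr.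
Qed.

Lemma noetherian_poly : noetherian A -> noetherian {poly A}.
Proof.
move=> hA I.
have [D LD] : exists D, forall d, lead_ideal d I `<=` lead_ideal D I.
  (* The lead ideals increase with [d], so their union is an ideal; [D] is a degree by which all of
     its finitely many generators have appeared. *)
  pose L : set A := [set a | exists d, lead_ideal_set d I a].
  have L0 : L 0 by exists 0%N; exact: lead_ideal0.
  have LD x y : L x -> L y -> L (x + y).
    move=> [d Ix] [e Iy]; exists (maxn d e).
    apply: lead_idealD.
      by apply: lead_ideal_leq Ix; lia.
    by apply: lead_ideal_leq Iy; lia.
  have LM c x : L x -> L (c * x) by move=> [d Ix]; exists d; exact: lead_idealM.
  have [s sE] := hA (Ideal L0 LD LM).
  have sL a : a \in s -> L a.
    move=> sa; rewrite -[L]/(ideal_set (Ideal L0 LD LM)) sE.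
    exact: sub_ideal_gen.
  have [D sD] : exists D, [set` s] `<=` lead_ideal D I.
    elim: s sL {sE} => [|a s IH] sL; first by exists 0%N => x.
    have [|e se] := IH.
      by move=> x xs; apply: sL; rewrite in_cons xs orbT.
    have [d ad] := sL a (mem_head _ _); exists (maxn d e) => x /=.
    rewrite in_cons => /predU1P[->|/se xe].
      by apply: lead_ideal_leq ad; lia.
    by apply: lead_ideal_leq xe; lia.
  exists D => d a Ia; apply: (ideal_gen_min sD); rewrite -sE; by exists d.
(* [S d] lifts finitely many generators of the [d]-th lead ideal to polynomials in [I]. The ideal
   [K] stays arbitrary because the final one is generated by several [S e] at once. *)
have /choice[S SP] : forall d, exists S : seq {poly A}, [set` S] `<=` I /\
    forall K, [set` S] `<=` K -> lead_ideal d I `<=` lead_ideal d K.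
  move=> d; have [s sE] := hA (lead_ideal d I).
  (* Choice needs a total function; the lift defaults to 0 off the lead ideal. *)
  have /choice[l lP] : forall a, exists p, lead_ideal_set d I a ->
      [/\ ideal_set I p, (size p <= d.+1)%N & p`_d = a].
    move=> a; have [[p pP]|na] := pselect (lead_ideal_set d I a).
      by exists p.
    by exists 0.
  have sL a : a \in s -> lead_ideal_set d I a.
    move=> sa; rewrite -[lead_ideal_set d I]/(ideal_set (lead_ideal d I)) sE.
    exact: sub_ideal_gen.
  exists (map l s); split=> [_ /mapP[a /sL/lP[Ia _ _] ->] //|K sK].
  rewrite sE; apply: ideal_gen_min => a sa.
  have [_ ls la] := lP a (sL a sa).
  by exists (l a); split=> //; apply: sK; exact: map_f.
exists (flatten [seq S d | d <- iota 0 D.+1]).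
set K := ideal_gen _; apply/ideal_eqP/seteqP.
have KI : K `<=` I.
  by apply: ideal_gen_min => p /flatten_mapP[d _] /(SP d).1.
split=> //; apply: lead_ideal_sub => // d.
have SK e : (e <= D)%N -> lead_ideal e I `<=` lead_ideal e K.
  move=> eD; apply: (SP e).2 => p Sp; apply: sub_ideal_gen.
  by apply/flatten_mapP; exists e; rewrite // mem_iota; lia.
(* Above [D], the lead ideal of [I] is already contained in the one at [D], where [K] catches up. *)
have [/SK //|lt_Dd] := leqP d D.
by move=> a /LD /(SK D (leqnn D)); apply: lead_ideal_leq; lia.
Qed.

End HilbertBasis.

(** * Points of LO determined by lifts; eta and specialization *)

Section LOEquality.
Variables (A : comNzRingType) (n : nat).

Lemma linear_eq (U V : lmodType A) (f g : {linear U -> V}) : f =1 g -> f = g.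
Proof.
case: f g => f cf [g cg] /= /funext fg; subst g; congr GRing.Linear.Pack.
case: cf cg => [[a] [b]] [[c] [e]].
by rewrite (Prop_irrelevance a c) (Prop_irrelevance b e).
Qed.

Definition LO_lift (x : LO A n) (f : 'I_n -> A) :=
  forall i, exists fI : f i \in ideal_set (LO_ideal x),
    LO_map x (delta_mx 0 i) = cotangent_class fI.

(** A linear map on A^n is determined on the basis. The targets of the two maps are different types
    until the ideals are identified, so they are compared through a common lift [f] in [A]. *)
Lemma LO_eq (x y : LO A n) (f : 'I_n -> A) :
  LO_ideal x = LO_ideal y -> LO_lift x f -> LO_lift y f -> x = y.
Proof.
case: x y => [I u su] [J v sv] /= IJ; subst J => xf yf.
suff E : u = v by subst v; congr MkLO; exact: Prop_irrelevance.
apply: linear_eq => w; rewrite [w]row_sum_delta !linear_sum.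
apply: eq_bigr => i _; rewrite !linearZ /=.
have [a ->] := xf i; have [b ->] := yf i; congr (_ *: _).
by apply/cotangent_class_eq; rewrite subrr; exact: ideal0.
Qed.

Lemma LO_lift_eta (v : Q2n A n) : LO_lift (eta v) (Q_f v 0).
Proof. by move=> i; exists (Q_f_mem v i); exact: eta_fun_delta. Qed.

Lemma zeta_lift_eta (x : LO A n) (v : Q2n A n) : zeta_lift x v -> eta v = x.
Proof. by move=> [xf _ xI]; apply: LO_eq (LO_lift_eta v) xf. Qed.

End LOEquality.

Lemma ideal_spec_Q_ideal (A : comNzRingType) (n : nat) (t : A)
    (H : Q2n {poly A} n) : ideal_spec t (Q_ideal H) = Q_ideal (Q_spec t H).
Proof.
apply/ideal_eqP/seteqP; split=> [_ [p /Q_idealP[a [b ->]] <-]|].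
  apply/Q_idealP; exists a.[t], (\row_i (b 0 i).[t]).
  rewrite hornerD hornerM horner_sum; congr (_ + _).
  by apply: eq_bigr => i _; rewrite hornerM !mxE.
apply: ideal_gen_min => _ [[i _ <-]|->].
  by exists (Q_f H 0 i); [exact: set_mem (Q_f_mem H i)|rewrite mxE].
by exists (Q_s H) => //; exact: set_mem (Q_s_mem H).
Qed.

Lemma LO_spec_eta (A : comNzRingType) (n : nat) (t : A) (H : Q2n {poly A} n) :
  LO_spec t (eta H) = eta (Q_spec t H).
Proof.
apply: LO_eq (LO_lift_eta _ _ _); first exact: ideal_spec_Q_ideal.
move=> i; have fI : Q_f (Q_spec t H) 0 i \in ideal_set (ideal_spec t (Q_ideal H)).
  by rewrite mxE; exact: ideal_spec_mem (Q_f_mem H i).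
exists fI; rewrite [LHS]/(LO_spec_fun _ _ _) /LO_spec_fun map_delta_mx /=.
rewrite eta_fun_delta cotangent_spec_class; apply/cotangent_class_eq.
by rewrite mxE subrr; exact: ideal0.
Qed.

(** * Deformations and homotopies in Q_2n *)

(** [F] generates I modulo I^2, so Nakayama gives [s] in I with (1 - s) I inside (F). Applied to [s]
    itself, this writes s (1 - s) as a combination of [F], whose coefficients are the new [g]. *)
Lemma Q_deform (A : comNzRingType) (n : nat) (v : Q2n A n) (F : 'rV[A]_n) :
  (forall i, ideal_set (ideal_sq (Q_ideal v)) (Q_f v 0 i - F 0 i)) ->
  exists w : Q2n A n, Q_f w = F /\ Q_ideal w = Q_ideal v.
Proof.
set I := Q_ideal v => fF.
pose S : set A := [set a | exists b : 'rV[A]_n, a = \sum_(i < n) F 0 i * b 0 i].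
have S0 : S 0 by exists 0; rewrite big1 // => i _; rewrite mxE mulr0.
have SD x y : S x -> S y -> S (x + y).
  move=> [b ->] [c ->]; exists (b + c); rewrite -big_split.
  by apply: eq_bigr => i _; rewrite mxE mulrDr.
have SM c x : S x -> S (c * x).
  move=> [b ->]; exists (c *: b); rewrite big_distrr.
  by apply: eq_bigr => i _; rewrite mxE /= mulrCA.
pose J := Ideal S0 SD SM.
have sq_sub a : ideal_set (ideal_sq I) a -> ideal_set I a.
  by apply: ideal_gen_min => _ [x _ [y Iy <-]]; exact: idealM.
have FI i : ideal_set I (F 0 i).
  have -> : F 0 i = Q_f v 0 i - (Q_f v 0 i - F 0 i) by ring.
  by apply: idealB (sq_sub _ (fF i)); exact: set_mem (Q_f_mem v i).
have JI a : ideal_set J a -> ideal_set I a.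
  by move=> [b ->]; apply: ideal_sum => i _; rewrite mulrC; exact: idealM.
have IJ a : ideal_set I a ->
    exists2 b, ideal_set J b & ideal_set (ideal_sq I) (a - b).
  move=> /Q_idealP[c [b ->]].
  (* By [Q_eq_s], modulo I^2 the element [Q_s v] is the sum of the g_i f_i, and each f_i may be
     replaced by F_i. *)
  exists (\sum_(i < n) F 0 i * (c *: Q_g v + b) 0 i).
    by exists (c *: Q_g v + b).
  have -> : c * Q_s v + \sum_(i < n) b 0 i * Q_f v 0 i -
      \sum_(i < n) F 0 i * (c *: Q_g v + b) 0 i =
      c * (Q_s v * Q_s v) +
      \sum_(i < n) (c * Q_g v 0 i + b 0 i) * (Q_f v 0 i - F 0 i).
    rewrite {1}Q_eq_s mulrDr -!addrA; congr (_ + _).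
    rewrite big_distrr -sumrB -big_split; apply: eq_bigr => i _.
    by rewrite /= !mxE; ring.
  apply: idealD; last by apply: ideal_sum => i _; exact: idealM.
  apply: idealM; apply: sub_ideal_gen; have s := set_mem (Q_s_mem v).
  by exists (Q_s v) => //; exists (Q_s v).
(* The listed elements generate I, so the last hypothesis of Nakayama holds with s = 0 and b = 0. *)
have [||s Is sP] := @ideal_sq_nakayama A I J
    (Q_s v :: [seq Q_f v 0 i | i <- enum 'I_n]) IJ.
- move=> y; rewrite in_cons => /predU1P[->|/mapP[i _ ->]].
    exact: set_mem (Q_s_mem v).
  exact: set_mem (Q_f_mem v i).
- exists 0; first exact: ideal0.
  move=> a Ia; exists 0; first exact: ideal0.
  rewrite !subr0 mul1r; apply: ideal_gen_min Ia => _ [[i _ <-]|->].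
    apply: sub_ideal_gen; rewrite /mkset in_cons map_f ?orbT //.
    by rewrite mem_enum.
  by apply: sub_ideal_gen; exact: mem_head.
have [g gE] := sP s Is.
have eqn : \sum_(i < n) F 0 i * g 0 i + s * (s - 1) = 0 by rewrite -gE; ring.
exists (MkQ2n eqn); split=> //; apply/ideal_eqP/seteqP; split.
  by apply: ideal_gen_min => _ [[i _ <-]|->].
move=> a Ia; have [b bE] := sP a Ia; apply/Q_idealP.
exists a, b => /=; rewrite [a in LHS](_ : a = a * s + (1 - s) * a); last by ring.
by rewrite bE; congr (_ + _); apply: eq_bigr => i _; rewrite mulrC.
Qed.

Lemma Q2n_eq (A : comNzRingType) (n : nat) (v w : Q2n A n) :
  Q_s v = Q_s w -> Q_f v = Q_f w -> Q_g v = Q_g w -> v = w.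
Proof.
case: v w => [s f g e] [s' f' g' e'] /= ss ff gg; subst s' f' g'.
by congr MkQ2n; exact: Prop_irrelevance.
Qed.

(* Modulo (f), both s and s' are idempotents generating I/(f), hence equal;
   so s' = s + \sum_i f_i c_i, and s can be moved linearly to s'. *)
Lemma Q_homotopy_same_f (A : comNzRingType) (n : nat) (v w : Q2n A n) :
  Q_f v = Q_f w -> Q_ideal v = Q_ideal w -> Q_homotopy v w.
Proof.
move=> fE IE; set f := Q_f v in fE.
have [a [b vE]] : exists a (b : 'rV_n),
    Q_s v = a * Q_s w + \sum_(i < n) b 0 i * f 0 i.
  by rewrite fE; apply/Q_idealP; rewrite -IE; exact: set_mem (Q_s_mem v).
have [a' [b' wE]] : exists a' (b' : 'rV_n),
    Q_s w = a' * Q_s v + \sum_(i < n) b' 0 i * f 0 i.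
  by apply/Q_idealP; rewrite IE; exact: set_mem (Q_s_mem w).
have := Q_eq v; have := Q_eq w; rewrite -fE -/f.
set s := Q_s v in vE wE *; set s' := Q_s w in vE wE *.
set G' := \sum_(i < n) _ => ew; set G := \sum_(i < n) _ => ev.
set B := \sum_(i < n) _ in vE; set B' := \sum_(i < n) _ in wE.
(* The first two terms are the coefficients of (1 - s) s' on [f], the last two, negated, those of (1
   - s') s; and (1 - s) s' - (1 - s') s = s' - s. *)
pose c := \row_i (b' 0 i * (1 - s) + a' * Q_g v 0 i
  - b 0 i * (1 - s') - a * Q_g w 0 i).
have cE : \sum_(i < n) f 0 i * c 0 i = s' - s.
  transitivity ((1 - s) * B' + a' * G - (1 - s') * B - a * G').
    rewrite ![_ * \sum_(_ < _) _]big_distrr -big_split -!sumrB.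
    by apply: eq_bigr => i _; rewrite /= !mxE; ring.
  have -> : G = s - s * s by rewrite -[LHS]subr0 -ev; ring.
  have -> : G' = s' - s' * s' by rewrite -[LHS]subr0 -ew; ring.
  have -> : B = s - a * s' by rewrite vE; ring.
  have -> : B' = s' - a' * s by rewrite wE; ring.
  by ring.
(* \sum_i f_i g_i(0) = s - s^2 and likewise at 1, so for S the interpolating
   line, the term T(1 - T)(s' - s)c in g makes up for the square in S - S^2. *)
pose S : {poly A} := s%:P + 'X * (s' - s)%:P.
pose g := \row_i ((Q_g v 0 i)%:P + 'X * (Q_g w 0 i - Q_g v 0 i)%:P
  + 'X * (1 - 'X) * ((s' - s) * c 0 i)%:P).
have eqn : \sum_(i < n) (map_mx polyC f) 0 i * g 0 i + S * (S - 1) = 0.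
  have -> : \sum_(i < n) (map_mx polyC f) 0 i * g 0 i =
      G%:P + 'X * (G' - G)%:P
      + 'X * (1 - 'X) * ((s' - s) * \sum_(i < n) f 0 i * c 0 i)%:P.
    rewrite -sumrB ![_ * \sum_(_ < _) _]big_distrr !rmorph_sum.
    rewrite ![_ * \sum_(_ < _) _]big_distrr -!big_split.
    by apply: eq_bigr => i _; rewrite /= !mxE !rmorphB !rmorphM; ring.
  have -> : G = s - s * s by rewrite -[LHS]subr0 -ev; ring.
  have -> : G' = s' - s' * s' by rewrite -[LHS]subr0 -ew; ring.
  by rewrite cE /S !(rmorphB, rmorphM); ring.
exists (MkQ2n eqn); split; apply: Q2n_eq => /=.
- by rewrite /S !hornerE.
- by apply/rowP => i; rewrite !mxE /horner_eval hornerC.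
- by apply/rowP => i; rewrite !mxE /horner_eval !hornerE.
- by rewrite /S hornerD hornerM hornerX !hornerC mul1r addrC subrK.
- by rewrite -fE; apply/rowP => i; rewrite !mxE /horner_eval hornerC.
- by apply/rowP => i; rewrite !mxE /horner_eval !hornerE /=; ring.
Qed.

Lemma eta_eq_homotopic (A : comNzRingType) (n : nat) (v w : Q2n A n) :
  eta v = eta w ->
  pi0_class (@Q_homotopy A n) v = pi0_class (@Q_homotopy A n) w.
Proof.
move=> vw; have IE : Q_ideal v = Q_ideal w := congr1 (@LO_ideal A n) vw.
have fE i : ideal_set (ideal_sq (Q_ideal v)) (Q_f v 0 i - Q_f w 0 i).
  have := LO_lift_eta _ _ w; rewrite -vw => /(_ i)[wI E].
  apply/(cotangent_class_eq (Q_f_mem v i) wI).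
  by rewrite -E [RHS]eta_fun_delta.
have polyC_sum (u u' : 'I_n -> A) (a b : A) :
    \sum_(i < n) (u i)%:P * (u' i)%:P + a%:P * (b%:P - 1) =
    (\sum_(i < n) u i * u' i + a * (b - 1))%:P.
  rewrite rmorphD rmorph_sum rmorphM rmorphB rmorph1; congr (_ + _).
  by apply: eq_bigr => i _; rewrite rmorphM.
(* [V] is [v] viewed over A[T]: the constant homotopy, with ideal I[T], whose f-part is then
   deformed to [F]. *)
have eqn : \sum_(i < n) (map_mx polyC (Q_f v)) 0 i * (map_mx polyC (Q_g v)) 0 i
    + (Q_s v)%:P * ((Q_s v)%:P - 1) = 0.
  by under eq_bigr do rewrite !mxE; rewrite polyC_sum Q_eq.
pose V := MkQ2n eqn.
have specV t : Q_spec t V = v.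
  apply: Q2n_eq => /=; first by rewrite hornerC.
    by apply/rowP => i; rewrite !mxE /horner_eval hornerC.
  by apply/rowP => i; rewrite !mxE /horner_eval hornerC.
have sqC a : ideal_set (ideal_sq (Q_ideal v)) a ->
    ideal_set (ideal_sq (Q_ideal V)) a%:P.
  have C x : ideal_set (Q_ideal v) x -> ideal_set (Q_ideal V) x%:P.
    move=> /Q_idealP[p [q ->]]; apply/Q_idealP; exists p%:P, (map_mx polyC q).
    rewrite rmorphD rmorphM rmorph_sum; congr (_ + _).
    by apply: eq_bigr => i _; rewrite rmorphM !mxE.
  move=> [m [p [u [Su ->]]]]; rewrite rmorph_sum; apply: ideal_sum => i _.
  rewrite rmorphM; apply: idealM; case: (Su i) => x Ix [y Iy <-].
  rewrite rmorphM; apply: sub_ideal_gen; exists x%:P; first exact: C.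
  by exists y%:P => //; exact: C.
pose F : 'rV[{poly A}]_n :=
  \row_i ((Q_f v 0 i)%:P + 'X * (Q_f w 0 i - Q_f v 0 i)%:P).
have [i|W [WF WI]] := @Q_deform _ _ V F.
  have -> : Q_f V 0 i - F 0 i = 'X * (Q_f v 0 i - Q_f w 0 i)%:P.
    by rewrite !mxE !rmorphB; ring.
  by apply: idealM; exact: sqC.
have specWI t : Q_ideal (Q_spec t W) = Q_ideal v.
  by rewrite -ideal_spec_Q_ideal WI ideal_spec_Q_ideal specV.
have Wf t : Q_f (Q_spec t W) = map_mx (horner_eval t) F by rewrite /= WF.
(* Three homotopies in a row: from [v] to W(0) with [f] fixed, along [W], and from W(1) to [w] with
   [f] fixed. *)
transitivity (pi0_class (@Q_homotopy A n) (Q_spec 0 W)).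
  apply/pi0_classP/rst_step/Q_homotopy_same_f; last by rewrite specWI.
  by rewrite Wf; apply/rowP => i; rewrite !mxE /horner_eval !hornerE.
transitivity (pi0_class (@Q_homotopy A n) (Q_spec 1 W)).
  by apply/pi0_classP/rst_step; exists W.
apply/pi0_classP/rst_step/Q_homotopy_same_f; last by rewrite specWI.
rewrite Wf; apply/rowP => i; rewrite !mxE /horner_eval.
by rewrite hornerD hornerM hornerX !hornerC mul1r addrC subrK.
Qed.

(** * Descent to pi_0 and the bijection *)

Lemma pi0_lift (X Y : choiceType) (r : X -> X -> Prop) (f : X -> Y) :
  (forall x y, r x y -> f x = f y) ->
  exists g : pi0 r -> Y, forall x, g (pi0_class r x) = f x.
Proof.
move=> rf; exists (fun c => f (repr c)) => x.
have rst_f y z : clos_refl_sym_trans X r y z -> f y = f z.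
  by elim=> [? ? /rf|?|? ? _ ->|? ? ? _ -> _ ->].
by apply/rst_f/pi0_classP; rewrite /pi0_class reprK.
Qed.

(** This is the independence of zeta from its choices: the point picked by [cid] has the same image
    under [eta] as [v]. *)
Lemma zeta_eta (A : comNzRingType) (n : nat) (hA : noetherian A)
    (v : Q2n A n) : zeta hA (eta v) = pi0_class (@Q_homotopy A n) v.
Proof.
apply: eta_eq_homotopic.
exact: zeta_lift_eta _ _ _ _ (projT2 (cid (zeta_lift_exists (eta v) hA))).
Qed.

Lemma LO_is_eta (A : comNzRingType) (n : nat) (hA : noetherian A)
    (x : LO A n) : exists v, x = eta v.
Proof.
have [v xv] := zeta_lift_exists x hA.
by exists v; rewrite (zeta_lift_eta _ _ _ _ xv).
Qed.

Theorem lemma2p3 (A : comNzRingType) (d n : nat)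
    (hA : noetherian A) (hd : krull_dim A d) (hn : (2 <= n)%N) :
  exists zetabar : pi0_LO A n -> pi0_Q A n,
    (forall x : LO A n,
       zetabar (pi0_class (@LO_homotopy A n) x) = zeta hA x) /\
    bijective zetabar /\
    exists etabar : pi0_Q A n -> pi0_LO A n,
      (forall v : Q2n A n,
         etabar (pi0_class (@Q_homotopy A n) v) =
         pi0_class (@LO_homotopy A n) (eta v)) /\
      cancel zetabar etabar /\ cancel etabar zetabar.
Proof.
have [zetabar zE] : exists zetabar : pi0_LO A n -> pi0_Q A n,
    forall x, zetabar (pi0_class (@LO_homotopy A n) x) = zeta hA x.
  apply: pi0_lift => _ _ [H [-> ->]].
  (* Since A[T] is noetherian, the homotopy is itself some [eta V], so its ends are the images under
     [eta] of the ends of [V]. *)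
  have [V ->] := LO_is_eta _ _ (noetherian_poly _ hA) H.
  rewrite !LO_spec_eta !zeta_eta; apply/pi0_classP/rst_step; by exists V.
have [etabar eE] : exists etabar : pi0_Q A n -> pi0_LO A n,
    forall v, etabar (pi0_class (@Q_homotopy A n) v) =
      pi0_class (@LO_homotopy A n) (eta v).
  apply: pi0_lift => _ _ [V [-> ->]]; apply/pi0_classP/rst_step.
  by exists (eta V); rewrite !LO_spec_eta.
(* Every class in pi_0 of LO is that of some [eta v], and the two maps exchange it with the class of
   [v]. *)
have zK : cancel zetabar etabar.
  move=> c; have [x ->] := pi0_class_surj c; have [v ->] := LO_is_eta _ _ hA x.
  by rewrite zE zeta_eta eE.
have eK : cancel etabar zetabar.
  by move=> c; have [v ->] := pi0_class_surj c; rewrite eE zE zeta_eta.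
exists zetabar; split=> //; split; first by exists etabar.
by exists etabar.
Qed.
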